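(* Let $n\in\mathbb{N}$ with $n\geq 2$, and let $G=K_{2,n}$. Then \[\tau(G)\leq \left\lceil \frac{n+2.05}{1.24}\right\rceil.\]
   Context: All graphs are finite and simple. A list assignment $L$ for a graph $G$ assigns to each vertex $v$ a set $L(v)$ of colors; it is an $m$-assignment if $|L(v)|=m$ for all $v$. A proper $L$-coloring is a proper coloring $f$ with $f(v)\in L(v)$ for all $v$; $P(G,L)$ is the number of proper $L$-colorings. $P(G,m)$ is the chromatic polynomial (number of proper colorings with colors from $\{1,\dots,m\}$). The list color function $P_\ell(G,m)$ is the minimum of $P(G,L)$ over all $m$-assignments $L$ for $G$. The list color function threshold $\tau(G)$ is the smallest integer $k\geq\chi(G)$ such that $P_\ell(G,m)=P(G,m)$ for every integer $m\geq k$. $K_{2,n}$ is the complete bipartite graph with parts of sizes $2$ and $n$. *)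

(* Defs.v *)
From mathcomp Require Import all_boot.
From mathcomp Require Import finmap boolp.

Set Implicit Arguments.
Unset Strict Implicit.
Unset Printing Implicit Defensive.

Record sgraph := SGraph {
  vertex :> finType;
  adj : rel vertex;
  adj_sym : symmetric adj;
  adj_irr : irreflexive adj
}.

Section CompleteBipartite.
Variables a b : nat.

Definition biclique_adj (u v : 'I_a + 'I_b) : bool :=
  match u, v with
  | inl _, inr _ | inr _, inl _ => true
  | _, _ => false
  end.

Lemma biclique_adj_sym : symmetric biclique_adj.
Proof. by case=> [?|?] [?|?]. Qed.

Lemma biclique_adj_irr : irreflexive biclique_adj.
Proof. by case. Qed.

Definition complete_bipartite : sgraph :=
  SGraph biclique_adj_sym biclique_adj_irr.

End CompleteBipartite.

Section Coloring.
Variable G : sgraph.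

Definition proper_coloring (C : eqType) (f : G -> C) : bool :=
  [forall u, forall v, adj u v ==> (f u != f v)].

Definition chromatic_poly (m : nat) : nat :=
  #|[set f : {ffun G -> 'I_m} | proper_coloring f]|.

Lemma colorable_ex : exists k, 0 < chromatic_poly k.
Proof.
exists #|G|; apply/card_gt0P; exists [ffun x => enum_rank x].
rewrite inE; apply/forallP => u; apply/forallP => v; apply/implyP => uv.
rewrite !ffunE (inj_eq enum_rank_inj).
by apply/eqP => euv; rewrite euv adj_irr in uv.
Qed.

Definition chromatic_number : nat := ex_minn colorable_ex.

(* Colors are natural numbers: as G is finite, any family of finite lists can
   be renamed injectively into nat without changing the number of colorings. *)
Definition list_assignment := G -> {fset nat}.

Definition is_assignment (m : nat) (L : list_assignment) : Prop :=
  forall v, #|` L v| = m.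

(* The dependent function type makes f v range over the elements of L v. *)
Definition nb_list_colorings (L : list_assignment) : nat :=
  #|[set f : {dffun forall v : G, L v} |
      proper_coloring (fun v => val (f v))]|.

Definition list_count_attained (m : nat) : pred nat := fun k =>
  `[< exists2 L, is_assignment m L & nb_list_colorings L = k >].

Lemma list_count_attained_ex m : exists k, list_count_attained m k.
Proof.
pose L : list_assignment := fun=> seq_fset tt (iota 0 m).
exists (nb_list_colorings L); apply/asboolP; exists L => // v.
by rewrite /L size_seq_fset undup_id ?iota_uniq // size_iota.
Qed.

Definition list_color_function (m : nat) : nat :=
  ex_minn (list_count_attained_ex m).

Definition agrees_from (k : nat) : Prop :=
  chromatic_number <= k /\
  forall m, k <= m -> list_color_function m = chromatic_poly m.

(* A relation rather than a function, since the existence of the threshold is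
   itself a theorem (Donner); at most one t satisfies it. *)
Definition is_list_color_threshold (t : nat) : Prop :=
  agrees_from t /\ forall k, agrees_from k -> t <= k.

End Coloring.

(* Main.v *)
(* Write A, B for the lists of the two vertices on the small side, C_j for the
   others, and s = m - 2. The number of list colorings is the sum over (a, b) in
   A x B of the product of the |C_j \ {a, b}|, and each factor is at least
   s + g_j(a, b), where g_j = 0 if a <> b both lie in C_j and g_j = 1 otherwise.
   If A = B, comparing termwise with constant lists is enough. If A <> B, each
   g_j sums to at least 2m - 1 over A x B, so Bernoulli's inequality
   \prod_j (s + g_j) >= s^n + s^(n-1) \sum_j g_j bounds the count below by
   s^n (m^2 + n (2m - 1) / s). This dominates the chromatic polynomial
   m (m - 1)^n + m (m - 1) s^n as soon as
   (1 + 1/s)^n <= 1 + n (2m - 1) / (m s), which is asymptotically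
   e^c <= 1 + 2c with c = n / m, whose threshold is slightly above 1.24. The exact
   inequality follows by bounding the binomial expansion up to degree 6. *)
Require Import Defs.
From mathcomp Require Import all_boot all_order all_algebra archimedean.
From mathcomp Require Import finmap boolp zify ring lra.
Import Order.TTheory GRing.Theory Num.Theory.
Local Open Scope ring_scope.

Set Implicit Arguments.
Unset Strict Implicit.
Unset Printing Implicit Defensive.

(** * The numerical inequality, over an ordered field *)

Section Numeric.
Variable F : realFieldType.
Implicit Types h x q : F.

(* The tail of the binomial expansion past degree k is dominated by a geometric
   series; the factor q stands for its sum. *)
Lemma expr1D_le_truncated_binomial (k n : nat) h q : 0 <= h -> 1 <= q ->
  q * ((n - k)%N%:R * h) <= (q - 1) * k.+1%:R ->
  (1 + h) ^+ n <=
    \sum_(i < k.+1) 'C(n, i)%:R * h ^+ i + q * 'C(n, k.+1)%:R * h ^+ k.+1.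
Proof.
move=> h0 q1; elim: n => [|n IHn] hn.
  rewrite big_ord_recl big1 => [|i _]; last by rewrite bin0n mul0r.
  by rewrite bin0n mulr0 mul0r !expr0 mulr1 !addr0.
have hn' : q * ((n - k)%N%:R * h) <= (q - 1) * k.+1%:R.
  apply: le_trans hn; rewrite ler_wpM2l ?ler_wpM2r ?ler_nat //; [lra|lia].
rewrite exprSr; apply: le_trans (ler_wpM2r _ (IHn hn')) _; first by lra.
(* By Pascal's rule, multiplying by [1 + h] yields the truncated sum for [n.+1] plus one spill-over
   term of degree [k.+1]. The slack [q - 1] must absorb this term. *)
have sumS : \sum_(i < k.+1) 'C(n.+1, i)%:R * h ^+ i + 'C(n, k)%:R * h ^+ k.+1 =
    (\sum_(i < k.+1) 'C(n, i)%:R * h ^+ i) * (1 + h).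
  rewrite mulrDr mulr1 [X in _ = X + _]big_ord_recl [X in _ = _ + X * h]big_ord_recr.
  rewrite big_ord_recl mulrDl mulr_suml /= !bin0 -!addrA; congr (_ + _).
  rewrite addrA; congr (_ + _); last by rewrite exprSr mulrA.
  rewrite -big_split; apply: eq_bigr => i _.
  by rewrite /= /bump /= add1n binS natrD exprS; ring.
rewrite mulrDl -sumS -addrA lerD2l binS natrD.
have e : k.+1%:R * 'C(n, k.+1)%:R = (n - k)%N%:R * 'C(n, k)%:R :> F.
  by rewrite -!natrM mul_bin_left.
have hk : 0 <= h ^+ k.+1 by exact: exprn_ge0.
suff: q * 'C(n, k.+1)%:R * h <= (q - 1) * 'C(n, k)%:R.
  move=> /(ler_wpM2r hk) H; lra.
rewrite -(ler_pM2l (ltr0Sn F k)).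
have -> : k.+1%:R * (q * 'C(n, k.+1)%:R * h) =
    q * ((n - k)%N%:R * h) * 'C(n, k)%:R.
  transitivity (q * h * (k.+1%:R * 'C(n, k.+1)%:R)); first by ring.
  by rewrite e; ring.
by rewrite [leRHS]mulrA [k.+1%:R * _]mulrC ler_wpM2r.
Qed.

(** A falling factorial over the field, in which [n] can then be replaced by a larger non-integer
    [x]. If [n <= k], both sides vanish. *)
Lemma bin_prod (n k : nat) :
  'C(n, k.+1)%:R * k.+1`!%:R =
    n%:R * \prod_(i < k) (n%:R - i.+1%:R) :> F.
Proof.
elim: k => [|k IHk]; first by rewrite bin1 big_ord0.
rewrite big_ord_recr /= mulrA -IHk factS natrM mulrA -natrM mulnC mul_bin_left.
have [le_kn|lt_nk] := leqP k.+1 n; first by rewrite natrM natrB //; ring.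
by rewrite bin_small ?muln0 ?mul0r.
Qed.

(** If [k < n], the factors are nonnegative and compare one by one. Otherwise the factor with
    [i.+1 = n] kills the left product, whatever the signs of the others. *)
Lemma prod_falling_le (n k : nat) x : (0 < n)%N -> n%:R <= x -> k%:R <= x ->
  0 <= \prod_(i < k) (n%:R - i.+1%:R : F) <= \prod_(i < k) (x - i.+1%:R).
Proof.
move=> n0 nx kx; case: (ltnP k n) => [lt_kn|le_nk].
  have le_in (i : 'I_k) : i.+1%:R <= n%:R :> F.
    by rewrite ler_nat (leq_trans (ltn_ord i)) // ltnW.
  rewrite prodr_ge0 => [|i _]; last by rewrite subr_ge0.
  by apply: ler_prod => i _; rewrite subr_ge0 le_in lerD2r.
have lt_nk : (n.-1 < k)%N by rewrite prednK.
rewrite [X in 0 <= X <= _](bigD1 (Ordinal lt_nk)) //= prednK // subrr mul0r lexx.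
apply: prodr_ge0 => i _; rewrite subr_ge0; apply: le_trans kx.
by rewrite ler_nat.
Qed.

(* With s = m - 2, the hypothesis is n <= 1.24 m - 2.05. *)
Lemma expr1DV_le (n s : nat) : (0 < n)%N -> (4 <= s)%N ->
  (100 * n <= 124 * s + 43)%N ->
  (1 + s%:R^-1) ^+ n <= 1 + n%:R * (2 * s%:R + 3) / (s%:R * (s%:R + 2)) :> F.
Proof.
move=> n0 s4 ns.
have s0 : 0 < s%:R :> F by rewrite ltr0n; lia.
set h := s%:R^-1; set x := 124 / 100 * s%:R + 43 / 100 : F.
have h0 : 0 < h by rewrite invr_gt0.
have sh : s%:R * h = 1 by rewrite divff ?gt_eqF.
have nx : n%:R <= x.
  have : (100 * n)%:R <= (124 * s + 43)%:R :> F by rewrite ler_nat.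
  by rewrite natrD !natrM /x => H; lra.
have x5 : 5 <= x.
  have : 4 <= s%:R :> F by rewrite ler_nat.
  by rewrite /x; lra.
pose p k := \prod_(i < k) (x - i.+1%:R).
(* Only the falling factors pass from [n] to [x]: the leading [n%:R * h] is kept, so that it cancels
   against the right-hand side. *)
have bin_le k : (k <= 5)%N ->
    'C(n, k.+1)%:R * h ^+ k.+1 <= n%:R * h * (p k * h ^+ k / k.+1`!%:R).
  move=> k5; have f0 : 0 < k.+1`!%:R :> F by rewrite ltr0n fact_gt0.
  have kx : k%:R <= x by apply: le_trans x5; rewrite ler_nat.
  have /andP[_ le_p] := prod_falling_le n0 nx kx.
  have -> : 'C(n, k.+1)%:R =
      n%:R * \prod_(i < k) (n%:R - i.+1%:R) / k.+1`!%:R :> F.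
    by rewrite -bin_prod mulfK ?gt_eqF.
  have -> : n%:R * h * (p k * h ^+ k / k.+1`!%:R) =
      n%:R * p k / k.+1`!%:R * h ^+ k.+1 by rewrite exprS; ring.
  apply: ler_wpM2r; first by rewrite exprn_ge0 ?ltW.
  apply: ler_wpM2r; first by rewrite invr_ge0 ltW.
  exact: ler_wpM2l.
(* Since [(n - 5) / s <= 1.24], the tail ratio is at most [1.24 / 6], whose geometric series sums to
   about 1.261; [q = 13 / 10] rounds this up. *)
have cond : 13 / 10 * ((n - 5)%N%:R * h) <= (13 / 10 - 1) * 6.
  have : (n - 5)%N%:R <= 124 / 100 * s%:R :> F.
    have [le_n5|lt_5n] := leqP n 5.
      by move: le_n5; rewrite -subn_eq0 => /eqP->; lra.
    by rewrite natrB 1?ltnW //; move: nx; rewrite /x; lra.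
  by move=> /(ler_wpM2r (ltW h0)); rewrite -[_ * s%:R * h]mulrA sh; lra.
have q1 : 1 <= 13 / 10 :> F by lra.
have := expr1D_le_truncated_binomial (ltW h0) q1 cond.
rewrite !big_ord_recl big_ord0 /= /bump /= !add1n bin0 expr0 mulr1 addr0.
have [[[[[b1 b2] b3] b4] b5] b6] :=
  (bin_le 0 isT, bin_le 1 isT, bin_le 2 isT, bin_le 3 isT, bin_le 4 isT,
   bin_le 5 isT)%N.
move: b1 b2 b3 b4 b5 b6.
rewrite -[1`!]/1%N -[2`!]/2%N -[3`!]/6%N -[4`!]/24%N -[5`!]/120%N -[6`!]/720%N.
rewrite /p !big_ord_recl !big_ord0 /= /bump /= !add1n !mulr1.
move=> b1 b2 b3 b4 b5 b6 le_sum; apply: le_trans le_sum _.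
pose T := 1 + (x - 1) * h / 2 + (x - 1) * (x - 2) * h ^+ 2 / 6
  + (x - 1) * (x - 2) * (x - 3) * h ^+ 3 / 24
  + (x - 1) * (x - 2) * (x - 3) * (x - 4) * h ^+ 4 / 120
  + 13 / 10 * (x - 1) * (x - 2) * (x - 3) * (x - 4) * (x - 5) * h ^+ 5 / 720.
apply: (@le_trans _ _ (1 + n%:R * h * T)); first by rewrite /T; lra.
have -> : n%:R * (2 * s%:R + 3) / (s%:R * (s%:R + 2)) =
    n%:R * h * ((2 * s%:R + 3) / (s%:R + 2)).
  by rewrite /h; field; rewrite !gt_eqF //; lra.
rewrite lerD2l; apply: ler_wpM2l; first by rewrite mulr_ge0 ?ler0n ?ltW.
have s2 : 0 < s%:R + 2 :> F by lra.
rewrite ler_pdivlMr // -(ler_pM2r (exprn_gt0 5 s0)).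
(* The difference is a polynomial in s - 4 with nonnegative coefficients. *)
have [v v0 sv] : exists2 v : F, 0 <= v & s%:R = v + 4.
  by exists (s%:R - 4); rewrite ?subrK // subr_ge0 ler_nat.
have -> : T * (s%:R + 2) * s%:R ^+ 5 = (s%:R + 2) * (s%:R ^+ 5
  + (x - 1) * s%:R ^+ 4 / 2 + (x - 1) * (x - 2) * s%:R ^+ 3 / 6
  + (x - 1) * (x - 2) * (x - 3) * s%:R ^+ 2 / 24
  + (x - 1) * (x - 2) * (x - 3) * (x - 4) * s%:R / 120
  + 13 / 10 * (x - 1) * (x - 2) * (x - 3) * (x - 4) * (x - 5) / 720).
  by rewrite /T /h; field; rewrite gt_eqF.
rewrite /x sv; have := exprn_ge0 2 v0; have := exprn_ge0 3 v0.
have := exprn_ge0 4 v0; have := exprn_ge0 5 v0; have := exprn_ge0 6 v0.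
lra.
Qed.

Lemma threshold_bound_nat (n k : nat) :
  (n%:R + 41 / 20) / (31 / 25) <= k%:R :> F -> (100 * n + 205 <= 124 * k)%N.
Proof.
have d0 : 0 < 31 / 25 :> F by lra.
by rewrite ler_pdivrMr // -(ler_nat F) natrD !natrM; lra.
Qed.

End Numeric.

(** * Counting list colorings and bounding the count below *)

Section Count.
Local Open Scope fset_scope.
Local Open Scope nat_scope.

Lemma card_sub_notin (X Y : {fset nat}) :
  #|[pred c : X | val c \notin Y]| = #|` X `\` Y|.
Proof.
transitivity (\sum_(c <- X | c \notin Y) 1).
  by rewrite big_seq_fsetE sum1_card.
rewrite sum1_count -size_filter; apply/perm_size/uniq_perm => //.
  by rewrite filter_uniq.
by move=> c; rewrite mem_filter !inE.
Qed.

Lemma sum_mem_fsetI (X Y : {fset nat}) :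
  \sum_(c <- X) (c \in Y : nat) = #|` X `&` Y|.
Proof.
rewrite -big_mkcond sum1_count -size_filter; apply/perm_size/uniq_perm => //.
  by rewrite filter_uniq.
by move=> c; rewrite mem_filter !inE andbC.
Qed.

(** Once the two vertices of the small side are colored [a] and [b], the other vertices are colored
    independently, each avoiding both colors. *)
Lemma nb_list_colorings_biclique2 n
    (L : list_assignment (complete_bipartite 2 n)) :
  nb_list_colorings L =
    \sum_(a <- L (inl ord0)) \sum_(b <- L (inl ord_max))
      \prod_(j < n) #|` L (inr j) `\` [fset a; b]|.
Proof.
pose u0 : complete_bipartite 2 n := inl ord0.
pose u1 : complete_bipartite 2 n := inl ord_max.
rewrite big_seq_fsetE; under eq_bigr do rewrite big_seq_fsetE.
rewrite pair_big /= /nb_list_colorings -sum1_card.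
rewrite (partition_big (fun f : {dffun forall v, L v} => (f u0, f u1)) predT) //=.
apply: eq_bigr => -[a b] _; rewrite sum1_card.
(* The fibre over [(a, b)] is the product of these predicates: singletons on the small side,
   avoidance of [a] and [b] on the other. Hence [card_family] counts it. *)
pose C (v : complete_bipartite 2 n) : pred (L v) :=
  fun c => match v with inl i => val c == (if i == ord0 then val a else val b)
                      | inr _ => val c \notin [fset val a; val b] end.
transitivity #|(family C : simpl_pred {dffun forall v, L v})|.
  apply: eq_card => f; rewrite [LHS]inE inE xpair_eqE /=.
  apply/idP/familyP.
  - case/andP => /forallP fp /andP[/eqP fa /eqP fb] [i|j].
      rewrite /C unfold_in; case: (i =P ord0) => [->|i0]; first by rewrite fa.
      have i1 : i = ord_max.
        apply/val_inj; move/eqP: i0; rewrite -val_eqE /=.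
        by have := ltn_ord i; lia.
      by rewrite i1 fb.
    rewrite /C unfold_in !inE -fa -fb negb_or.
    have /forallP fp' := fp (inr j).
    by rewrite (implyP (fp' u0)) // (implyP (fp' u1)).
  - move=> fC; have fa : f u0 = a by apply/val_inj/eqP/(fC u0).
    have fb : f u1 = b by apply/val_inj/eqP/(fC u1).
    rewrite fa fb !eqxx !andbT.
    have fj i j : val (f (inl i)) != val (f (inr j)).
      have := fC (inr j); rewrite /C unfold_in !inE negb_or => /andP[ja jb].
      have := fC (inl i); rewrite /C unfold_in => /eqP->.
      by case: ifP => _; rewrite eq_sym.
    apply/forallP => -[i|j]; apply/forallP => -[i'|j'] //; apply/implyP => _ //.
      exact: fj.
    by rewrite eq_sym; exact: fj.
rewrite (card_family C) foldrE big_image /= big_sumType /= !big_ord_recl big_ord0 /=.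
have C0 : #|C (inl ord0)| = 1 by apply: (@eq_card1 _ a) => c.
have C1 i : i = ord_max -> #|C (inl i)| = 1.
  by move=> ->; apply: (@eq_card1 _ b) => c.
rewrite C0 C1; last exact/val_inj.
rewrite !mul1n; apply: eq_bigr => j _; rewrite -card_sub_notin.
by apply: eq_card => c.
Qed.

Lemma card_fsetD2 (C : {fset nat}) a b :
  #|` C| = #|` C `\` [fset a; b]| + (a \in C) + ((b != a) && (b \in C)).
Proof.
rewrite (cardfsD1 a) (cardfsD1 b (C `\ a)) in_fsetD1 fsetDDl; lia.
Qed.

Lemma sum_sum_diag (A : {fset nat}) x y :
  \sum_(a <- A) \sum_(b <- A) (if b == a then x else y) =
    #|` A| * (x + #|` A|.-1 * y).
Proof.
have inner a : a \in A ->
    \sum_(b <- A) (if b == a then x else y) = x + #|` A|.-1 * y.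
  move=> aA; rewrite (bigD1_seq a) ?fset_uniq //= eqxx; congr (_ + _).
  under eq_bigr => b /negbTE-> do [].
  rewrite big_const_seq iter_addn_0 mulnC; congr (_ * _).
  have := count_predC (pred1 a) A; rewrite count_uniq_mem ?fset_uniq // aA.
  by rewrite add1n => <-.
rewrite big_seq (eq_bigr _ inner) -big_seq big_const_seq iter_addn_0.
by rewrite count_predT mulnC.
Qed.

(* If x, y, z are the sizes of A `&` C, B `&` C and A `&` B `&` C, the pairs that
   do not count number x * y - z, while x + y - z <= m and x, y <= m, with one of
   the last two strict; hence x * y - z <= (m - 1) ^ 2. *)
Lemma sum_good_pairs (A B C : {fset nat}) m :
  #|` A| = m -> #|` B| = m -> #|` C| = m -> A != B ->
  (2 * m).-1 <=
    \sum_(a <- A) \sum_(b <- B) ~~ [&& b != a, a \in C & b \in C].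
Proof.
move=> Am Bm Cm neqAB; set S := (X in _ <= X).
(* Pointwise, the indicator in [S] plus that of [a] and [b] both in [C] is 1, except on the diagonal
   inside [C], where it is 2. *)
have SE : S + #|` A `&` C| * #|` B `&` C| = m * m + #|` A `&` C `&` B|.
  rewrite -(sum_mem_fsetI A C) -(sum_mem_fsetI B C) big_distrlr -big_split /=.
  under eq_bigr do rewrite -big_split /=.
  have <- : \sum_(a <- A) \sum_(b <- B) (1 + (b == a) * (a \in C)) =
      m * m + #|` A `&` C `&` B|.
    under eq_bigr do rewrite big_split /= sum1_size Bm.
    rewrite big_split /= big_const_seq count_predT iter_addn_0 Am; congr (_ + _).
    rewrite -fsetIA -sum_mem_fsetI; apply: eq_bigr => a _.
    rewrite -big_distrl -big_mkcond sum1_count /= count_uniq_mem ?fset_uniq //.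
    by rewrite mulnb andbC inE.
  apply: eq_bigr => a _; apply: eq_bigr => b _.
  by case: eqP => [->|_] /=; case: (a \in C); case: (b \in C).
have eqC (D : {fset nat}) : #|` D| = m -> m <= #|` D `&` C| -> D = C.
  move=> Dm le_m; transitivity (D `&` C); apply/eqP.
    by rewrite eq_sym eqEfcard fsubsetIl Dm.
  by rewrite eqEfcard fsubsetIr Cm.
have : #|` A `&` C| < m \/ #|` B `&` C| < m.
  case: (ltnP #|` A `&` C| m) => [|/(eqC _ Am) AC]; first by left.
  right; rewrite ltnNge; apply: contra neqAB => /(eqC _ Bm) BC.
  by rewrite AC BC.
have : #|` A `&` C| <= m by rewrite -Am fsubset_leq_card ?fsubsetIl.
have : #|` B `&` C| <= m by rewrite -Bm fsubset_leq_card ?fsubsetIl.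
have : #|` A `&` C| + #|` B `&` C| <= m + #|` A `&` C `&` B|.
  have -> : A `&` C `&` B = (A `&` C) `&` (B `&` C).
    by apply/fsetP => c; rewrite !inE; case: (c \in C); rewrite ?andbF ?andbT.
  rewrite -cardfsUI leq_add2r -Cm fsubset_leq_card // -fsetIUl.
  exact: fsubsetIr.
move: SE; move: #|` A `&` C| #|` B `&` C| #|` A `&` C `&` B| => x y z; clearbody S.
case: x => [|x]; first by nia.
case: y => [|y]; first by nia.
move=> SE le_xy le_y le_x lt_xy.
(* Here [x] and [y] are the sizes minus 1. As [z >= x + y + 2 - m], the excluded pairs number at
   most [x * y + m - 1], to be compared with [(m - 1) ^ 2]. *)
suff : x * y <= (m - 1) * (m - 2) by nia.
by case: lt_xy => ?; [rewrite mulnC|]; apply: leq_mul; lia.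
Qed.

(** Bernoulli's inequality, multiplied by [s] to avoid the exponent [n - 1] and any division. Each
    induction step discards the product of [g ord_max] with the sum of the earlier terms. *)
Lemma prodn_addl_ge (n s : nat) (g : 'I_n -> nat) :
  s ^ n * (s + \sum_(j < n) g j) <= (\prod_(j < n) (s + g j)) * s.
Proof.
elim: n g => [|n IHn] g; first by rewrite !big_ord0 mul1n addn0 mul1n.
rewrite !big_ord_recr /=; set S := \sum_(i < n) _; set P := \prod_(i < n) _.
have : s ^ n * (s + S) <= P * s by exact: IHn.
move=> /(leq_mul (leqnn (s + g ord_max))) IH.
rewrite mulnAC [P * s * _]mulnC; apply: leq_trans IH.
rewrite expnSr -mulnA [leqRHS]mulnCA leq_mul2l; apply/orP; right; nia.
Qed.

(** This lets the chromatic polynomial be computed by the formula for list colorings, and bounds the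
    list color function above. *)
Lemma chromatic_poly_const_lists (G : sgraph) (m : nat) :
  chromatic_poly G m = nb_list_colorings (fun _ : G => seq_fset tt (iota 0 m)).
Proof.
set X := seq_fset tt (iota 0 m).
have memX (i : 'I_m) : val i \in X by rewrite seq_fsetE mem_iota ltn_ord.
have ltX (x : X) : val x < m by have := valP x; rewrite seq_fsetE mem_iota.
pose e i : X := FSetSub (memX i); pose e' x := Ordinal (ltX x).
pose phi (f : {ffun G -> 'I_m}) : {dffun forall v : G, X} := [ffun v => e (f v)].
have phi_inj : injective phi.
  move=> f g /ffunP fg; apply/ffunP => v; apply/val_inj.
  by have := congr1 val (fg v); rewrite !ffunE.
rewrite /nb_list_colorings /chromatic_poly -(card_imset _ phi_inj).
apply: eq_card => g; rewrite [RHS]inE; apply/imsetP/idP => [[f]|gp].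
  rewrite inE => /forallP fp ->; apply/forallP => u; apply/forallP => v.
  by rewrite !ffunE; apply: (forallP (fp u)).
exists [ffun v => e' (g v)].
  rewrite inE; apply/forallP => u; apply/forallP => v.
  by rewrite !ffunE; apply: (forallP (forallP gp u)).
by apply/ffunP => v; apply/val_inj; rewrite !ffunE.
Qed.

Lemma expnS_le_linear (n s : nat) : 0 < n -> 2 <= s -> 100 * n <= 124 * s + 43 ->
  (s + 2) * s * s.+1 ^ n <= s ^ n * ((s + 2) * s + n * (2 * s + 3)).
Proof.
(* The field estimate starts at [s = 4]. Below it, the hypothesis leaves six pairs [(s, n)], checked
   by computation. *)
move=> n0 s2 ns; have [s4|lt_s4] := leqP 4 s; last first.
  have : ((s == 2) && (n \in [:: 1; 2]))
      || ((s == 3) && (n \in [:: 1; 2; 3; 4])).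
    by rewrite !inE; lia.
  by case/orP => /andP[/eqP->]; rewrite !inE; repeat case/orP; move=> /eqP->.
have s0 : (0 < s%:R :> rat)%R by rewrite ltr0n; lia.
have s20 : (0 < s%:R + 2 :> rat)%R by lra.
have sn0 : (0 < s%:R ^+ n :> rat)%R by rewrite exprn_gt0.
rewrite -(ler_nat rat) -(addn1 s) !(natrM, natrD, natrX).
have -> : (s%:R + 1 = s%:R * (1 + s%:R^-1) :> rat)%R.
  by field; rewrite gt_eqF.
rewrite exprMn mulrCA ler_pM2l //.
apply: le_trans (ler_wpM2l _ (expr1DV_le rat n0 s4 ns)) _.
  by rewrite mulr_ge0 ?ltW.
by rewrite le_eqVlt; apply/orP; left; apply/eqP; field; rewrite !gt_eqF.
Qed.

Lemma nb_list_colorings_biclique2_ge (m n : nat)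
    (L : list_assignment (complete_bipartite 2 n)) :
  0 < n -> 4 <= m -> 100 * n + 205 <= 124 * m -> is_assignment m L ->
  m * (m.-1 ^ n + m.-1 * m.-2 ^ n) <= nb_list_colorings L.
Proof.
move=> n0 m4 mn Lm; rewrite nb_list_colorings_biclique2.
set A := L (inl ord0); set B := L (inl ord_max).
have Am : #|` A| = m by exact: Lm.
have Bm : #|` B| = m by exact: Lm.
have [eqAB|neqAB] := eqVneq A B.
  rewrite -{1 3}Am -eqAB -sum_sum_diag.
  apply: leq_sum => a _; apply: leq_sum => b _.
  have card_ge (j : 'I_n) : (if b == a then m.-1 else m.-2) <=
      #|` L (inr j) `\` [fset a; b]|.
    have := card_fsetD2 (L (inr j)) a b; rewrite Lm.
    by move: (a \in L (inr j)) (b \in L (inr j)); case: eqP => _ [] [] /=; lia.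
  apply: leq_trans (leq_prod (fun j _ => card_ge j)).
  by rewrite prod_nat_const card_ord; case: ifP.
pose s := m.-2; have sm : m = s + 2 by rewrite /s; lia.
have s0 : 0 < s by lia.
pose g j a b : nat := ~~ [&& b != a, a \in L (inr j) & b \in L (inr j)].
have card_ge (j : 'I_n) a b : s + g j a b <= #|` L (inr j) `\` [fset a; b]|.
  have := card_fsetD2 (L (inr j)) a b; rewrite Lm /g.
  by case: (b != a); case: (a \in L _); case: (b \in L _) => /=; lia.
rewrite -(leq_pmul2r s0) big_distrl /=.
apply: (@leq_trans (\sum_(a <- A) \sum_(b <- B)
    s ^ n * (s + \sum_(j < n) g j a b))); last first.
  apply: leq_sum => a _; rewrite big_distrl; apply: leq_sum => b _ /=.
  apply: leq_trans (prodn_addl_ge _ _) _; rewrite leq_mul2r; apply/orP; right.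
  by apply: leq_prod => j _.
have -> : \sum_(a <- A) \sum_(b <- B) s ^ n * (s + \sum_(j < n) g j a b) =
    s ^ n * (m * m * s + \sum_(j < n) \sum_(a <- A) \sum_(b <- B) g j a b).
  rewrite [X in _ + X]exchange_big.
  under [X in _ + X]eq_bigr do rewrite exchange_big.
  have -> : m * m * s = \sum_(a <- A) \sum_(b <- B) s.
    by rewrite !big_const_seq !count_predT !iter_addn_0 Am Bm; lia.
  rewrite -big_split big_distrr; apply: eq_bigr => a _ /=.
  by rewrite -big_split big_distrr.
have sum_ge : n * (2 * s + 3) <= \sum_(j < n) \sum_(a <- A) \sum_(b <- B) g j a b.
  rewrite -{1}(card_ord n) -sum_nat_const; apply: leq_sum => j _.
  have := sum_good_pairs Am Bm (Lm (inr j)) neqAB; apply: leq_trans; lia.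
(* With [m = s + 2], [124 * m - 205] becomes [124 * s + 43]. *)
have num : (s + 2) * s * s.+1 ^ n <= s ^ n * ((s + 2) * s + n * (2 * s + 3)).
  by apply: expnS_le_linear => //; lia.
have -> : m.-1 = s.+1 by lia.
apply: (@leq_trans (s ^ n * (m * m * s + n * (2 * s + 3)))); last first.
  by rewrite leq_mul2l leq_add2l sum_ge orbT.
rewrite -/s sm; move: num; move: (s ^ n) (s.+1 ^ n) => x y; nia.
Qed.

Lemma chromatic_poly_biclique2 (m n : nat) :
  chromatic_poly (complete_bipartite 2 n) m = m * (m.-1 ^ n + m.-1 * m.-2 ^ n).
Proof.
rewrite chromatic_poly_const_lists nb_list_colorings_biclique2.
set X := seq_fset tt (iota 0 m).
have Xm : #|` X| = m by rewrite size_seq_fset undup_id ?iota_uniq // size_iota.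
rewrite -{1 3}Xm -sum_sum_diag big_seq [RHS]big_seq.
apply: eq_bigr => a aX; rewrite big_seq [RHS]big_seq; apply: eq_bigr => b bX.
rewrite prod_nat_const card_ord.
have := card_fsetD2 X a b; rewrite aX bX Xm.
by case: eqP => _ /= e; congr (_ ^ _); lia.
Qed.

(** * From the lower bound to the threshold *)

Lemma list_color_function_le (G : sgraph) (m : nat) :
  list_color_function G m <= chromatic_poly G m.
Proof.
rewrite /list_color_function; case: ex_minnP => k _; apply.
apply/asboolP; eexists; last exact/esym/chromatic_poly_const_lists.
by move=> v; rewrite size_seq_fset undup_id ?iota_uniq // size_iota.
Qed.

Lemma biclique2_agrees_from (n k : nat) : 2 <= n -> 100 * n + 205 <= 124 * k ->
  agrees_from (complete_bipartite 2 n) k.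
Proof.
move=> n2 nk; split.
  rewrite /chromatic_number; case: ex_minnP => c _; apply.
  by rewrite chromatic_poly_biclique2 muln_gt0 addn_gt0 expn_gt0; lia.
move=> m km; apply/anti_leq; rewrite list_color_function_le /=.
rewrite /list_color_function; case: ex_minnP => c /asboolP[L Lm <-] _.
rewrite chromatic_poly_biclique2.
(* From [n >= 2] one gets [124 * m >= 405], hence [m >= 4]. *)
by apply: nb_list_colorings_biclique2_ge => //; lia.
Qed.

End Count.

Theorem theorem9 (n : nat) (hn : (2 <= n)%N) :
  exists t : nat,
    is_list_color_threshold (complete_bipartite 2 n) t /\
    t%:Z <= Num.ceil ((n%:Q + 2.05%Q) / 1.24%Q).
Proof.
set x := (X in Num.ceil X).
have x0 : 0 <= x by rewrite divr_ge0 ?addr_ge0 ?ler0z.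
have [k ceilE] : exists k : nat, Num.ceil x = k.
  exists `|Num.ceil x|%N; rewrite gez0_abs // ceil_ge0.
  by apply: lt_le_trans x0.
have nk : (100 * n + 205 <= 124 * k)%N.
  have : x <= k%:Q by rewrite -ceilE Num.Theory.ceil_ge.
  have e205 : 2.05%Q = 41 / 20 by apply/eqP; vm_compute.
  have e124 : 1.24%Q = 31 / 25 by apply/eqP; vm_compute.
  by rewrite /x e205 e124; exact: (@threshold_bound_nat rat).
(* Agreement from the ceiling [k] on does double duty: it makes a least such integer, the threshold,
   exist, and it bounds that integer. *)
have ex : exists k, `[< agrees_from (complete_bipartite 2 n) k >].
  by exists k; apply/asboolP; exact: biclique2_agrees_from.
case: (ex_minnP ex) => t /asboolP tP t_min; exists t; split; first split=> //.
  by move=> j jP; apply/t_min/asboolP.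
by rewrite ceilE lez_nat; apply/t_min/asboolP/biclique2_agrees_from.
Qed.
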